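(* Let $\Bbbk$ be an infinite field, $S=\Bbbk[x_1,\ldots,x_n]$ and $\mathfrak m=(x_1,\ldots,x_n)$. For any matroid $\Delta$ on $[n]$, the ideal $I_\Delta S_{\mathfrak m}$ is a set-theoretic complete intersection in $S_{\mathfrak m}$.
   Context: A simplicial complex $\Delta$ on $[n]=\{1,\ldots,n\}$ is a collection of subsets closed under taking subsets; its facets are its maximal elements. $\Delta$ is a matroid if for any two facets $F,G$ and any $i\in F$ there is $j\in G$ such that $(F\setminus\{i\})\cup\{j\}$ is a facet. The Stanley–Reisner ideal is $I_\Delta=(x_{i_1}\cdots x_{i_s}:\{i_1,\ldots,i_s\}\notin\Delta)\subseteq S$. An ideal $\mathfrak a$ of a Noetherian ring $R$ is a set-theoretic complete intersection if its arithmetical rank, the minimal $k$ such that there exist $r_1,\ldots,r_k\in R$ with $\sqrt{(r_1,\ldots,r_k)}=\sqrt{\mathfrak a}$, equals $\operatorname{ht}(\mathfrak a)$. *)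

(* Defs.v *)
From HB Require Import structures.
From mathcomp Require Import all_boot all_order all_algebra.
From mathcomp Require Import boolp classical_sets cardinality.
From mathcomp Require Export mpoly.

Set Implicit Arguments.
Unset Strict Implicit.
Unset Printing Implicit Defensive.

Import GRing.Theory.
Local Open Scope ring_scope.
Local Open Scope classical_set_scope.

(* MathComp with mathcomp-classical: an ideal of a commutative ring R is a term
   of type [set R]. *)

Section Ideals.
Variable R : comNzRingType.
Implicit Types (A I P : set R).

Definition ideal_gen A : set R :=
  [set x | exists s : nat, exists c a : 'I_s -> R,
     (forall i, A (a i)) /\ x = \sum_(i < s) c i * a i].

Definition radical I : set R := [set x | exists m : nat, I (x ^+ m)].

(* [idealr_closed] includes properness (1 is not in P). *)
Definition prime_ideal P : Prop :=
  idealr_closed (mem P) /\ prime_idealr_closed (mem P).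

(* There is a chain c 0 < c 1 < ... < c h = P of prime ideals. *)
Definition prime_chain_to P (h : nat) : Prop :=
  exists c : nat -> set R,
    [/\ forall i, (i <= h)%N -> prime_ideal (c i),
        forall i, (i < h)%N -> c i `<` c i.+1
      & c h = P].

Definition has_prime_height P (h : nat) : Prop :=
  prime_chain_to P h /\ forall h', prime_chain_to P h' -> (h' <= h)%N.

(* The minimum of the heights of the primes containing I; primes of infinite
   height do not affect it, and the unit ideal has no (finite) height. *)
Definition has_height I (h : nat) : Prop :=
  (exists P, [/\ prime_ideal P, I `<=` P & has_prime_height P h]) /\
  (forall P h', prime_ideal P -> I `<=` P -> has_prime_height P h' ->
     (h <= h')%N).

Definition radically_generated I (k : nat) : Prop :=
  exists r : 'I_k -> R, radical (ideal_gen (range r)) = radical I.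

Definition has_arithmetical_rank I (k : nat) : Prop :=
  radically_generated I k /\
  forall k', radically_generated I k' -> (k <= k')%N.

Definition set_theoretic_complete_intersection I : Prop :=
  exists h : nat, has_height I h /\ has_arithmetical_rank I h.

End Ideals.

Section IdealTheory.
Variables (R : comNzRingType) (A : set R).
Implicit Types x y : R.

Lemma ideal_genD x y :
  ideal_gen A x -> ideal_gen A y -> ideal_gen A (x + y).
Proof.
move=> [s [c [a [Aa ->]]]] [t [d [b [Ab ->]]]].
exists (s + t)%N, (fun i => match split i with inl j => c j | inr j => d j end),
  (fun i => match split i with inl j => a j | inr j => b j end).
split=> [i|]; first by case: split.
rewrite big_split_ord /=; congr (_ + _); apply: eq_bigr => i _.
  by rewrite (unsplitK (inl i)).
by rewrite (unsplitK (inr i)).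
Qed.

Lemma ideal_genM x y : ideal_gen A y -> ideal_gen A (x * y).
Proof.
move=> [s [c [a [Aa ->]]]]; exists s, (fun i => x * c i), a; split=> //.
by rewrite mulr_sumr; apply: eq_bigr => i _; rewrite mulrA.
Qed.

Lemma ideal_gen0 : ideal_gen A 0.
Proof.
by exists 0%N, (fun=> 0), (fun=> 0); split=> [[]//|]; rewrite big_ord0.
Qed.

End IdealTheory.

Section PrimeIdealTheory.
Variables (R : comNzRingType) (P : set R) (pP : prime_ideal P).

Lemma prime_ideal1 : ~ P 1.
Proof. by case: pP => -[_ h _] _ /mem_set; apply/negP. Qed.

Lemma prime_idealMN (b c : R) : ~ P b -> ~ P c -> ~ P (b * c).
Proof.
by move=> hb hc /mem_set h; case: pP => _ /(_ b c h) /orP[] /set_mem.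
Qed.

Lemma prime_ideal_neq0 (b : R) : ~ P b -> b != 0.
Proof.
move=> hb; apply/eqP => b0; apply: hb; rewrite b0.
by case: pP => -[/set_mem].
Qed.

End PrimeIdealTheory.

(* The localization R_P of a domain R at a prime P, as the subring of the
   fraction field of R formed by the fractions a / b with b outside P.  The
   primality proof is carried by the type, so that the ring structure of R_P
   can be inferred from it. *)
Section Localization.
Variables (R : idomainType) (P : set R) (pP : prime_ideal P).

Definition loc_pred of prime_ideal P : {pred {fraction R}} :=
  mem [set x : {fraction R} |
       exists a b : R, ~ P b /\ x = tofrac a / tofrac b].

Lemma loc_predP (x : {fraction R}) :
  reflect (exists a b : R, ~ P b /\ x = tofrac a / tofrac b)
          (x \in loc_pred pP).
Proof. by apply: (iffP idP) => [/set_mem|h]; [|apply/mem_set]. Qed.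

Lemma loc_subring_closed : subring_closed (loc_pred pP).
Proof.
split.
- apply/loc_predP; exists 1, 1; split; first exact: prime_ideal1.
  by rewrite rmorph1 divr1.
- move=> _ _ /loc_predP[a [b [hb ->]]] /loc_predP[c [d [hd ->]]].
  apply/loc_predP; exists (a * d - c * b), (b * d); split.
    exact: prime_idealMN.
  rewrite -mulNr addf_div ?tofrac_eq0 ?(prime_ideal_neq0 pP) //.
  by rewrite rmorphB !rmorphM mulNr.
- move=> _ _ /loc_predP[a [b [hb ->]]] /loc_predP[c [d [hd ->]]].
  apply/loc_predP; exists (a * c), (b * d); split.
    exact: prime_idealMN.
  by rewrite mulf_div !rmorphM.
Qed.

HB.instance Definition _ := GRing.isSubringClosed.Build {fraction R}
  (loc_pred pP) loc_subring_closed.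

Record localization :=
  Localization { loc_val : {fraction R}; _ : loc_val \in loc_pred pP }.

HB.instance Definition _ := [isSub for loc_val].
HB.instance Definition _ := [Choice of localization by <:].
HB.instance Definition _ :=
  [SubChoice_isSubComNzRing of localization by <:].

Lemma loc_tofrac (a : R) : tofrac a \in loc_pred pP.
Proof.
apply/loc_predP; exists a, 1; split; first exact: prime_ideal1.
by rewrite rmorph1 divr1.
Qed.

Definition to_loc (a : R) : localization := Localization (loc_tofrac a).

(* The extension I R_P of an ideal I of R. *)
Definition loc_ideal (I : set R) : set localization :=
  ideal_gen (to_loc @` I).

End Localization.

Arguments loc_ideal {R P} pP I.

Section PolynomialRing.
Variables (k : fieldType) (n : nat).
Notation S := {mpoly k[n]}.

(* (x_1, ..., x_n) *)
Definition irrelevant_ideal : set S :=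
  ideal_gen (range (fun i : 'I_n => 'X_i : S)).

Lemma mpolyX_irrelevant (m : 'X_{1..n}) :
  m != 0%MM -> irrelevant_ideal 'X_[m].
Proof.
move=> m0; have [i mi] : exists i, m i != 0%N.
  apply/existsP; rewrite -negb_forall; apply: contraNN m0 => /forallP h.
  by apply/eqP/mnmP => i; rewrite mnm0E; apply/eqP.
exists 1%N, (fun=> 'X_[(m - U_(i))%MM]), (fun=> 'X_i).
split=> [_|]; first by exists i.
rewrite big_ord1 -mpolyXD submK //; apply/mnm_lepP => j; rewrite mnm1E.
by case: eqP => // <-; rewrite lt0n.
Qed.

Lemma irrelevant_idealP (p : S) :
  irrelevant_ideal p <-> p.@[fun=> 0] = 0.
Proof.
have ev0 q : irrelevant_ideal q -> q.@[fun=> 0] = 0.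
  move=> [s [c [a [Aa ->]]]].
  rewrite raddf_sum big1 //= => i _; have [j _ <-] := Aa i.
  by rewrite mevalM mevalXU mulr0.
split=> [|p0]; first exact: ev0.
have [c pc] : exists c, irrelevant_ideal (p - c%:MP).
  rewrite [p]mpolyE.
  apply: (big_ind (fun q : S => exists c, irrelevant_ideal (q - c%:MP))).
  - by exists 0; rewrite mpolyC0 subr0; apply: ideal_gen0.
  - move=> q r [c hc] [d hd]; exists (c + d).
    by rewrite mpolyCD opprD addrACA; apply: ideal_genD.
  move=> m _; have [->|m0] := eqVneq m 0%MM.
    exists p@_0; rewrite mpolyX0 alg_mpolyC subrr; exact: ideal_gen0.
  exists 0; rewrite mpolyC0 subr0 -mul_mpolyC.
  by apply: ideal_genM; apply: mpolyX_irrelevant.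
have /eqP := ev0 _ pc.
by rewrite mevalB mevalC p0 sub0r oppr_eq0 => /eqP c0; move: pc;
  rewrite c0 mpolyC0 subr0.
Qed.

Lemma irrelevant_ideal_prime : prime_ideal irrelevant_ideal.
Proof.
split; first split.
- exact/mem_set/ideal_gen0.
- apply/negP => /set_mem /irrelevant_idealP.
  by rewrite meval1; apply/eqP/oner_neq0.
- move=> a u v /set_mem hu /set_mem hv; apply/mem_set.
  by apply: ideal_genD => //; apply: ideal_genM.
move=> u v /set_mem /irrelevant_idealP /eqP.
rewrite mevalM mulf_eq0 => /orP[] /eqP h; apply/orP; [left|right];
  exact/mem_set/irrelevant_idealP.
Qed.

End PolynomialRing.

Section Complexes.
Variable n : nat.
Implicit Types (Delta : {set {set 'I_n}}) (F G : {set 'I_n}).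

Definition is_complex Delta : Prop :=
  forall F G, F \in Delta -> G \subset F -> G \in Delta.

Definition facet Delta F : bool := maxset (mem Delta) F.

(* The void complex, which has no facet, is not a matroid. *)
Definition is_matroid Delta : Prop :=
  [/\ Delta != finset.set0, is_complex Delta
    & forall F G, facet Delta F -> facet Delta G ->
        forall i, i \in F ->
          exists2 j, j \in G & facet Delta (j |: (F :\ i))%SET].

Definition Stanley_Reisner (k : fieldType) Delta : set {mpoly k[n]} :=
  ideal_gen
    [set p | exists2 F, F \notin Delta & p = \prod_(i in F) 'X_i].

End Complexes.

Arguments Stanley_Reisner {n} k Delta.

(* Main.v *)
From HB Require Import structures.
Require Import Defs.
From mathcomp Require Import all_boot all_order all_algebra zify ring.
From mathcomp Require Import boolp classical_sets cardinality.
From mathcomp Require Import mpoly.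

(** Let h be the cardinality of the complement of a facet of Delta; by basis
exchange all facets have the same size, so h does not depend on the facet. For
A a set of indices let P_A be the prime ideal generated by the x_i with i in A.
A prime containing I_Delta contains P_A for A the complement of some facet
([prime_over_Stanley_Reisner]), and P_A has height #|A|, so the height of
I_Delta is h, before and after localization. It remains to find h generators
up to radical, and to show that fewer do not suffice.

Upper bound. The nullity of a set C is #|C| minus its rank; it is positive
exactly on the non-faces and at most h. Call C cyclic if every proper subset
has smaller nullity (C is then a union of circuits, that is, the complement of
a flat of the dual matroid), and let f_j be the sum of the squarefree monomials
x_C over the cyclic C of nullity j, for 1 <= j <= h. Nullity is supermodular,
hence the union of two distinct cyclic sets C, D of nullity j has nullity greater
than j, and it contains a cyclic set E of that larger nullity; thus x_E divides
x_C x_D. Hence x_C f_j is x_C ^ 2 up to multiples of cyclic monomials of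
larger nullity, and descending induction on j puts all the x_C, and therefore
I_Delta, in the radical of (f_1, ..., f_h). This is the argument of Schmitt and
Vogel ([Schmitt_Vogel]).

Height of P_A. Given a strict chain of primes c_0 < ... < c_l in k[x_1..x_n],
choose y_i in c_(i+1) outside c_i. Were l > n, the y_i would be algebraically
dependent; but in a relation among them the lexicographically smallest monomial
cannot be cancelled by the others ([chain_independent]). So l <= n
([prime_chain_dimension]), and a chain ending in P_A, which can be prolonged by
n - #|A| coordinate primes up to the maximal ideal, has length at most #|A|.

Lower bound. Suppose that l elements of the local ring generate I_Delta up to
radical. After clearing denominators, they are l polynomials a_j of P_A such
that s x_i ^ N lies in (a) for every i in A, with s outside P_A. As k is
infinite, s does not vanish at some point v whose coordinates in A are zero.
Adding the n - #|A| polynomials x_i - v_i, for i outside A, gives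
l + n - #|A| polynomials that vanish at v and generate, near v, an ideal
containing a power of each x_i - v_i. Counting dimensions modulo high powers
of the maximal ideal of v shows that at least n polynomials are needed
([primary_generators_ge]), so #|A| <= l. *)

Set Implicit Arguments.
Unset Strict Implicit.
Unset Printing Implicit Defensive.
Import GRing.Theory.

(** * Rank and nullity in a matroid *)

Section Matroid.
Variables (n : nat) (Delta : {set {set 'I_n}}).
Hypothesis mD : is_matroid Delta.
Implicit Types A B C F G I J : {set 'I_n}.

Lemma face_sub F G : F \in Delta -> G \subset F -> G \in Delta.
Proof. by case: mD => _ h _; apply: h. Qed.

Lemma facet_face G : facet Delta G -> G \in Delta.
Proof. exact: maxsetp. Qed.

Lemma face_facet F : F \in Delta -> exists2 G, facet Delta G & F \subset G.
Proof. by move=> FD; have [G] := maxset_exists (P := mem Delta) FD; exists G. Qed.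

Lemma exists_facet : exists G, facet Delta G.
Proof.
case: mD => /set0Pn[F FD] _ _; have [G fG _] := face_facet FD.
by exists G.
Qed.

(** The element supplied by the exchange axiom is automatically new: if it
were in F minus i, that set would be a facet properly contained in F. *)
Lemma facet_exchange F G i : facet Delta F -> facet Delta G -> i \in F :\: G ->
  exists j, [/\ j \in G :\: F, facet Delta (j |: F :\ i)
              & #|j |: F :\ i| = #|F|].
Proof.
case: mD => _ _ ex fF fG; rewrite inE => /andP[iG iF].
have [j jG fj] := ex F G fF fG i iF.
have jF : j \notin F.
  apply: contraL jG => jF; have [->//|ji] := eqVneq j i.
  have e : j |: F :\ i = F :\ i.
    by apply/finset.setUidPr; rewrite finset.sub1set !inE ji jF.
  rewrite e in fj.
  have /maxsetP[_ /(_ F (facet_face fF) (subsetDl _ _))] := fj.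
  by move/setP/(_ i); rewrite !inE eqxx iF.
exists j; split=> //; first by rewrite inE jF.
by rewrite cardsU1 !inE (negbTE jF) andbF (cardsD1 i F) iF.
Qed.

(** Exchanging the elements of F outside G one at a time keeps the size of F
and ends with a facet contained in G. *)
Lemma facet_card F G : facet Delta F -> facet Delta G -> #|F| = #|G|.
Proof.
move: {2}#|F :\: G| (leqnn #|F :\: G|) => m.
elim: m F => [|m IH] F.
  rewrite leqn0 cards_eq0 finset.setD_eq0 => FG /maxsetP[_ mF] fG.
  by rewrite (mF G (facet_face fG) FG).
move=> le fF fG; have [/eqP|/set0Pn[i iFG]] := boolP (F :\: G == finset.set0).
  by move=> e; apply: IH => //; rewrite e cards0.
have [j [jG fj <-]] := facet_exchange fF fG iFG.
apply: IH => //; rewrite -ltnS; apply: leq_trans le.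
rewrite (cardsD1 i (F :\: G)) iFG ltnS; apply: subset_leq_card.
apply/fintype.subsetP => x; rewrite !inE; move: jG; rewrite inE.
by have [-> /andP[_ ->]|] := eqVneq x j; case: (x == i); case: (x \in G).
Qed.

(** The independence axiom, from which everything about the rank follows. *)
Lemma face_augment I J : I \in Delta -> J \in Delta -> #|I| < #|J| ->
  exists2 j, j \in J :\: I & j |: I \in Delta.
Proof.
move=> /face_facet[F0 fF0 IF0] /face_facet[G fG JG] ltIJ.
pose P F := facet Delta F && (I \subset F).
have PF0 : P F0 by rewrite /P fF0.
(* Among the facets through I, one that meets G as much as possible leaves G
   only along I: any other point of it could be exchanged for one of G. *)
case: (arg_maxnP (fun F => #|F :&: G|) PF0) => F /andP[fF IF] maxF.
have FIG : F :\: I \subset G.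
  apply/fintype.subsetP => x; rewrite inE => /andP[xI xF]; apply/negPn/negP => xG.
  have [|j [jG fj _]] := @facet_exchange F G x fF fG; first by rewrite inE xG.
  have /maxF : P (j |: F :\ x).
    rewrite /P fj /=; apply/fintype.subsetP => y yI.
    rewrite !inE (fintype.subsetP IF) // andbT.
    by apply/orP; right; apply: contraNneq xI => <-.
  apply/negP; rewrite -ltnNge.
  have -> : (j |: F :\ x) :&: G = j |: (F :&: G).
    apply/setP => y; move: jG; rewrite !inE.
    have [-> /andP[_ ->]//|_ _] := eqVneq y j; rewrite /= -andbA.
    by have [->|//] := eqVneq y x; rewrite (negbTE xG) !andbF.
  by move: jG; rewrite cardsU1 !inE => /andP[/negbTE -> _].
have [/set0Pn[j]|/negPn/eqP e0] := boolP (J :&: (F :\: I) != finset.set0).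
  rewrite !inE => /and3P[jJ jI jF]; exists j; first by rewrite inE jI.
  by apply: face_sub (facet_face fF) _; rewrite finset.subUset finset.sub1set jF.
have : #|F :\: I| <= #|G :\: J|.
  apply: subset_leq_card; apply/fintype.subsetP => x xFI.
  rewrite inE (fintype.subsetP FIG) // andbT; apply/negP => xJ.
  by move/setP/(_ x): e0; rewrite inE xJ xFI inE.
rewrite !cardsD (finset.setIidPr IF) (finset.setIidPr JG) (facet_card fF fG).
have := subset_leq_card JG; have := subset_leq_card IF.
by rewrite (facet_card fF fG); lia.
Qed.

Definition rank A := \max_(I in Delta | I \subset A) #|I|.

Lemma face0 : finset.set0 \in Delta.
Proof.
have [G fG] := exists_facet.
exact: face_sub (facet_face fG) (finset.sub0set _).
Qed.

Lemma rank_ge I A : I \in Delta -> I \subset A -> #|I| <= rank A.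
Proof.
move=> ID IA; apply: (leq_bigmax_cond (F := fun I : {set 'I_n} => #|I|)).
by rewrite ID.
Qed.

Lemma rank_le A m :
  (forall I, I \in Delta -> I \subset A -> #|I| <= m) -> rank A <= m.
Proof. by move=> h; apply/bigmax_leqP => I /andP[]; apply: h. Qed.

Lemma rank_extend I A : I \in Delta -> I \subset A ->
  exists J, [/\ J \in Delta, I \subset J, J \subset A & #|J| = rank A].
Proof.
move=> ID IA; pose P J := [&& J \in Delta, I \subset J & J \subset A].
have PI : P I by rewrite /P ID subxx.
case: (arg_maxnP (fun J : {set _} => #|J|) PI) => J /and3P[JD IJ JA] maxJ.
exists J; split=> //; apply/eqP; rewrite eqn_leq rank_ge //=.
apply: rank_le => K KD KA; rewrite leqNgt; apply/negP => ltJK.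
have [j /setDP[jK jJ] jD] := face_augment JD KD ltJK.
have /maxJ : P (j |: J).
  rewrite /P jD (fintype.subset_trans IJ (finset.subsetUr _ _)) /=.
  rewrite finset.subUset JA finset.sub1set andbT.
  exact: (fintype.subsetP KA).
by rewrite /= cardsU1 jJ add1n ltnn.
Qed.

(** Extend a maximal face X of the intersection to a maximal face Y of the
union: by maximality Y meets the intersection in X alone, and the traces of Y
on A and on B bound the two ranks from below. *)
Lemma rank_submod A B : rank (A :|: B) + rank (A :&: B) <= rank A + rank B.
Proof.
have [X [XD _ XAB cX]] := rank_extend face0 (finset.sub0set (A :&: B)).
have IU := fintype.subset_trans (subsetIl A B) (finset.subsetUl A B).
have [Y [YD XY YAB <-]] := rank_extend XD (fintype.subset_trans XAB IU).
have e : Y :&: A :&: (Y :&: B) = X.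
  apply/eqP; rewrite eq_sym eqEcard finset.subsetI !finset.subsetI XY /=.
  move: XAB; rewrite finset.subsetI => /andP[-> ->] /=.
  rewrite cX rank_ge //; last by rewrite finset.setIACA subsetIr.
  by apply: face_sub YD _; rewrite finset.setIACA finset.setIid subsetIl.
have u : Y :&: A :|: Y :&: B = Y by rewrite -finset.setIUr; apply/finset.setIidPl.
rewrite -cX -e -{1}u cardsUI leq_add // rank_ge ?subsetIr //.
  by apply: face_sub YD (subsetIl _ _).
by apply: face_sub YD (subsetIl _ _).
Qed.

Definition nullity A := #|A| - rank A.

Lemma rank_card A : rank A <= #|A|.
Proof. by apply: rank_le => I _; apply: subset_leq_card. Qed.

Lemma nullity_supermod A B :
  nullity A + nullity B <= nullity (A :|: B) + nullity (A :&: B).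
Proof.
rewrite /nullity; have := rank_submod A B; have := cardsUI A B.
have := (rank_card A, rank_card B, rank_card (A :|: B), rank_card (A :&: B)).
by move=> [[[]]]; lia.
Qed.

Lemma nullity0 : nullity finset.set0 = 0.
Proof. by rewrite /nullity cards0. Qed.

Lemma nullity_mono A B : A \subset B -> nullity A <= nullity B.
Proof.
move=> AB; have := nullity_supermod A (B :\: A).
have -> : A :&: (B :\: A) = finset.set0.
  by apply/setP => x; rewrite !inE; case: (x \in A).
have -> : A :|: B :\: A = B.
  apply/setP => x; rewrite !inE.
  by have [/(fintype.subsetP AB) ->|] := boolP (x \in A).
by rewrite nullity0 addn0; apply: leq_trans; apply: leq_addr.
Qed.

Lemma nullity_gt0 A : (0 < nullity A) = (A \notin Delta).
Proof.
rewrite /nullity subn_gt0 ltnNge; congr (~~ _).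
apply/idP/idP => [|AD]; last exact: rank_ge.
have [J [JD _ JA <-]] := rank_extend face0 (finset.sub0set A) => cJ.
by have /eqP <- : J == A by rewrite eqEcard JA.
Qed.

Lemma nullityT G : facet Delta G -> nullity finset.setT = #|~: G|.
Proof.
move=> fG; rewrite /nullity cardsT card_ord cardsCs finset.setCK card_ord.
congr (_ - _); apply/eqP.
rewrite eqn_leq rank_ge ?finset.subsetT ?facet_face // andbT.
apply: rank_le => I /face_facet[F fF IF] _.
by rewrite -(facet_card fF fG); apply: subset_leq_card.
Qed.

(** These are the unions of circuits of Delta, or equivalently the
complements of the flats of the dual matroid. *)
Definition cyclic_set A := minset (fun B => nullity A <= nullity B) A.

Lemma cyclic_subset A :
  exists C, [/\ C \subset A, nullity C = nullity A & cyclic_set C].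
Proof.
have [C mC CA] := minset_exists (P := fun B => nullity A <= nullity B) (leqnn _).
have e : nullity C = nullity A.
  by apply/eqP; rewrite eqn_leq (minsetp mC) nullity_mono.
exists C; split=> //; apply/minsetP; split=> // B.
by rewrite e; have /minsetP[_] := mC; apply.
Qed.

(** If the nullity did not grow, supermodularity would give the intersection
the nullity of A and B, hence, A and B being minimal, make it equal to both. *)
Lemma cyclic_union A B : cyclic_set A -> cyclic_set B ->
  nullity A = nullity B -> A != B -> nullity A < nullity (A :|: B).
Proof.
move=> /minsetP[_ mA] /minsetP[_ mB] e; apply: contraNltn => le.
have := nullity_supermod A B => sm.
have IA : nullity A <= nullity (A :&: B) by lia.
by rewrite -{1}(mA _ IA (subsetIl _ _)) (mB (A :&: B)) ?subsetIr // -e.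
Qed.

End Matroid.

Local Open Scope ring_scope.
Local Open Scope classical_set_scope.

(** * Ideals, primes and chains *)

Section Ideals.
Variable R : comNzRingType.
Implicit Types (A B J P Q : set R) (u v x : R).

Definition is_ideal J :=
  [/\ J 0, forall u v, J u -> J v -> J (u + v) & forall u v, J v -> J (u * v)].

Lemma ideal_gen_is_ideal A : is_ideal (ideal_gen A).
Proof.
split; [exact: ideal_gen0|exact: ideal_genD|by move=> u v; apply: ideal_genM].
Qed.

Lemma ideal_sum J (I : Type) (r : seq I) (p : pred I) (F : I -> R) :
  is_ideal J -> (forall i, p i -> J (F i)) -> J (\sum_(i <- r | p i) F i).
Proof. by case=> J0 JD _ JF; apply: (big_ind J). Qed.

Lemma sub_ideal_gen A : A `<=` ideal_gen A.
Proof.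
move=> a Aa; exists 1%N, (fun=> 1), (fun=> a); split=> //.
by rewrite big_ord1 mul1r.
Qed.

Lemma ideal_gen_min A J : is_ideal J -> A `<=` J -> ideal_gen A `<=` J.
Proof.
move=> iJ AJ _ [s [c [a [Aa ->]]]]; apply: ideal_sum => // i _.
by case: iJ => _ _; apply; apply: AJ.
Qed.

Lemma sub_radical J : J `<=` radical J.
Proof. by move=> x Jx; exists 1%N; rewrite expr1. Qed.

Lemma radical_is_ideal J : is_ideal J -> is_ideal (radical J).
Proof.
move=> iJ; have [J0 _ JM] := iJ; split.
- by exists 1%N; rewrite expr1.
- move=> u v [a ua] [b vb]; exists (a + b)%N; rewrite exprDn.
  apply: ideal_sum => // i _; rewrite -mulr_natl; apply: (JM).
  have [ltib|leib] := ltnP i b.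
    rewrite (_ : (a + b - i)%N = (b - i + a)%N); last by move: ltib; lia.
    by rewrite exprD mulrAC; apply: (JM).
  by rewrite -[X in v ^+ X](subnK leib) exprD mulrA; apply: JM.
- by move=> u v [b vb]; exists b; rewrite exprMn; apply: JM.
Qed.

Lemma radicalX J x m : radical J (x ^+ m) -> radical J x.
Proof. by move=> [k h]; exists (m * k)%N; rewrite exprM. Qed.

Lemma radical_min J Q : J `<=` radical Q -> radical J `<=` radical Q.
Proof. by move=> JQ x [m /JQ /radicalX]. Qed.

(** [prime_ideal] is phrased with boolean membership; proofs need the
propositional form. *)
Lemma prime_idealP P :
  prime_ideal P <->
  [/\ is_ideal P, ~ P 1 & forall u v, P (u * v) -> P u \/ P v].
Proof.
split=> [pP|[[P0 PD PM] P1 pP]].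
  have [[/set_mem P0 _ PD] pr] := pP; split; last 2 first.
  - exact: prime_ideal1 pP.
  - by move=> u v /mem_set /pr /orP[] /set_mem; [left|right].
  have PM u v : P v -> P (u * v).
    move=> /mem_set v_P; rewrite -[u * v]addr0; apply/set_mem/PD => //.
    exact: mem_set.
  split=> // u v /mem_set Pu /mem_set Pv; rewrite -[u]mul1r; exact/set_mem/PD.
split; first split.
- exact: mem_set.
- by apply/negP => /set_mem.
- by move=> a u v /set_mem Pu /set_mem Pv; apply/mem_set/PD => //; apply: PM.
by move=> u v /set_mem /pP[] h; apply/orP; [left|right]; apply: mem_set.
Qed.

Lemma prime_prod P (I : Type) (r : seq I) (p : pred I) (F : I -> R) :
  prime_ideal P -> P (\prod_(i <- r | p i) F i) -> exists2 i, p i & P (F i).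
Proof.
move=> /prime_idealP[_ P1 PM]; elim: r => [|i r IH]; first by rewrite big_nil.
by rewrite big_cons; case: ifP => [pi /PM[Pi|]|_]//; exists i.
Qed.

Lemma primeX P x m : prime_ideal P -> P (x ^+ m) -> P x.
Proof.
move=> pP; rewrite -[m]card_ord -prodr_const => /(prime_prod pP).
by case.
Qed.

Lemma radical_prime_sub P J : prime_ideal P -> J `<=` P -> radical J `<=` P.
Proof. by move=> pP JP x [m /JP]; apply: primeX. Qed.

Lemma prime_chain_extend P Q h :
  prime_chain_to P h -> prime_ideal Q -> P `<` Q -> prime_chain_to Q h.+1.
Proof.
move=> [c [pc cc ch]] pQ PQ; exists (fun i => if (i <= h)%N then c i else Q).
split=> [i _|i|]; last by rewrite ltnn.
  by case: ifP => // /pc.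
rewrite ltnS => leih; rewrite leih; case: ltnP => [/cc//|lehi].
by have -> : i = h by [lia]; rewrite ch.
Qed.

(** Only the last prime of the chain is replaced, which also covers P = Q. *)
Lemma prime_chain_enlarge P Q h :
  prime_chain_to P h -> prime_ideal Q -> P `<=` Q -> prime_chain_to Q h.
Proof.
move=> [c [pc cc ch]] pQ PQ; exists (fun i => if (i < h)%N then c i else Q).
split=> [i _|i ltih|]; last by rewrite ltnn.
  by case: ifP => // /ltnW /pc.
rewrite ltih; case: ltnP => [_|lehi]; first exact: cc.
have eh : i.+1 = h by lia.
have := cc i ltih; rewrite eh ch => ciP; split; first exact: subset_trans ciP.1 PQ.
by move=> Qci; apply: ciP.2; apply: subset_trans Qci.
Qed.

End Ideals.

(** * The radical of the cyclic sums *)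

Section SchmittVogel.
Local Open Scope set_scope.
Variables (n : nat) (Delta : {set {set 'I_n}}) (R : comNzRingType) (x : 'I_n -> R).
Hypothesis mD : is_matroid Delta.
Implicit Types (C D : {set 'I_n}).
Local Notation xprod C := (\prod_(i in C) x i).

Definition cyclic_sum j : R :=
  \sum_(C : {set 'I_n} | cyclic_set Delta C && (nullity Delta C == j)) xprod C.

Lemma ideal_prod_sub (J : set R) C D : is_ideal J -> C \subset D ->
  J (xprod C) -> J (xprod D).
Proof.
move=> [_ _ JM] CD JC; rewrite (big_setID C) /= (finset.setIidPr CD) mulrC.
exact: JM.
Qed.

(** In x_C f_j, with j the nullity of C, every term other than x_C ^ 2 is
divisible by a monomial x_E with E cyclic of larger nullity. Descending
induction on the nullity thus gives the claim for cyclic C, and any non-face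
contains a cyclic set of the same positive nullity. *)
Lemma Schmitt_Vogel (J : set R) h :
  is_ideal J -> (forall x, J (x ^+ 2) -> J x) ->
  (forall C, (nullity Delta C <= h)%N) ->
  (forall j, (0 < j <= h)%N -> J (cyclic_sum j)) ->
  forall C, C \notin Delta -> J (xprod C).
Proof.
move=> iJ J2 leh Jf; have [J0 JD JM] := iJ.
suff cyc d C : (h - nullity Delta C < d)%N -> (0 < nullity Delta C)%N ->
    cyclic_set Delta C -> J (xprod C).
  move=> C; rewrite -nullity_gt0 // => C0.
  have [D [DC eD cD]] := cyclic_subset mD C.
  by apply: ideal_prod_sub DC _ => //; apply: (cyc _ _ (ltnSn _)) cD; rewrite eD.
elim: d C => // d IH C ltd C0 cC.
have Cj : J (cyclic_sum (nullity Delta C)) by apply: Jf; rewrite C0 leh.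
have := JM (xprod C) _ Cj; rewrite /cyclic_sum (bigD1 C) ?cC ?eqxx //= mulrDr => h1.
apply: J2; rewrite expr2 -[_ * _](addrK (xprod C * (\sum_(D : {set 'I_n} |
  cyclic_set Delta D && (nullity Delta D == nullity Delta C) && (D != C)) xprod D))).
apply: (JD) => //; rewrite -mulN1r; apply: (JM); rewrite mulr_sumr.
apply: ideal_sum => // D /andP[/andP[cD /eqP eD] DC].
(* For E below, x_E divides the monomial of C :|: D, which divides x_C x_D. *)
have lt : (nullity Delta C < nullity Delta (D :|: C))%N.
  by rewrite -eD; apply: cyclic_union.
have [E [EDC eE cE]] := cyclic_subset mD (D :|: C).
have JE : J (xprod E).
  by apply: IH cE; have := leh C; have := leh (D :|: C)%SET; rewrite eE; lia.
have := ideal_prod_sub iJ EDC JE.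
rewrite (big_setID C) /= (finset.setIidPr (finset.subsetUr _ _)) => h2.
have -> : xprod D = xprod (D :\: C) * xprod (D :&: C).
  by rewrite [LHS](big_setID C) mulrC.
rewrite finset.setDUl finset.setDv finset.setU0 in h2.
by rewrite mulrA mulrC; apply: (JM).
Qed.
End SchmittVogel.

(** * The dimension of a polynomial ring *)

(** There are more vectors than coordinates. Both dimension counts below rest
on this. *)
Lemma exists_linear_relation (k : fieldType) (A B : finType) (f : A -> B -> k) :
  (#|A| < #|B|)%N ->
  exists l : B -> k, (exists b, l b != 0) /\ forall a, \sum_b l b * f a b = 0.
Proof.
move=> ltAB; pose M := \matrix_(i < #|B|, j < #|A|) f (enum_val j) (enum_val i).
have : kermx M != 0.
  rewrite kermx_eq0 /row_free; apply: contraTneq ltAB => <-.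
  by rewrite -leqNgt rank_leq_col.
case/rowV0Pn=> v /sub_kermxP vM v0; exists (fun b => v 0 (enum_rank b)); split.
  apply/existsP; apply: contraNT v0; rewrite negb_exists => /forallP h.
  apply/eqP/rowP => j; rewrite mxE -[j]enum_valK; apply/eqP.
  by have := h (enum_val j); rewrite negbK.
move=> a; have /rowP/(_ (enum_rank a)) := vM.
rewrite !mxE => vMa; rewrite -[RHS]vMa.
rewrite (reindex (@enum_val _ B)) /=; last exact: onW_bij (enum_val_bij _).
by apply: eq_bigr => j _; rewrite mxE !enum_rankK enum_valK.
Qed.

Section ChainIndependence.
Variables (R : comNzRingType) (l : nat) (c : nat -> set R) (y : nat -> R).
Hypothesis c_prime : forall i, (i <= l)%N -> prime_ideal (c i).
Hypothesis c_mono : forall i, (i < l)%N -> c i `<=` c i.+1.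
Hypothesis cy : forall i, (i < l)%N -> c i.+1 (y i) /\ ~ c i (y i).

(** The exponents e a play the role of the monomials of a relation between
y i, ..., y l.-1, with coefficients outside the top prime; the hypothesis of
injectivity says that they are distinct as monomials in these variables.
Divide by the smallest power of y i that occurs, which is permitted since c i
is prime and does not contain y i. Modulo c i.+1, which contains y i, only the
terms of smallest exponent survive, and they involve the later variables
only. When no variable is left, a single coefficient remains. *)
Lemma chain_independent (T : finType) (L : {set T}) (g : T -> R)
    (e : T -> nat -> nat) i :
  (i <= l)%N -> L != finset.set0 -> (forall a, a \in L -> ~ c l (g a)) ->
  {in L &, forall a b, (forall j, (i <= j < l)%N -> e a j = e b j) -> a = b} ->
  ~ c i (\sum_(a in L) g a * \prod_(i <= j < l) y j ^+ e a j).
Proof.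
move=> leil; move: {2}(l - i)%N (erefl (l - i)%N) => d.
elim: d => [|d IH] in i leil L *.
all: move=> di L0 gL inj.
  have {di leil} ei : i = l by lia.
  have [a aL] := set0Pn _ L0; have -> : L = [set a]%SET.
    apply/setP => b; rewrite !inE; apply/idP/eqP => [bL|->//].
    by apply: inj => // j; rewrite ei; case: ltngtP.
  by rewrite big_set1 ei big_geq // mulr1; apply: gL.
have {leil} ltil : (i < l)%N by lia.
have [a0 a0L] := set0Pn _ L0.
case: (arg_minnP (fun a => e a i) a0L) => a1 a1L min {a0 a0L}.
(* m is the smallest exponent of y i, and L1 is the set of terms that attain it. *)
set m := e a1 i in min; pose L1 := [set a in L | e a i == m]%SET.
have [iP _ PM] := (prime_idealP _).1 (c_prime (ltnW ltil)).
have [iP' _ _] := (prime_idealP _).1 (c_prime ltil).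
have -> : \sum_(a in L) g a * \prod_(i <= j < l) y j ^+ e a j = y i ^+ m *
  (\sum_(a in L1) g a * \prod_(i.+1 <= j < l) y j ^+ e a j +
   y i * \sum_(a in L :\: L1)
     g a * y i ^+ (e a i - m).-1 * \prod_(i.+1 <= j < l) y j ^+ e a j).
  rewrite (big_setID L1) mulrDr !mulr_sumr /=; congr (_ + _).
    have /finset.setIidPr -> : L1 \subset L.
      by apply/fintype.subsetP => a; rewrite inE => /andP[].
    apply: eq_bigr => a; rewrite inE => /andP[_ /eqP ea].
    by rewrite big_ltn // ea mulrCA.
  apply: eq_bigr => a; rewrite !inE => /andP[/nandP h aL].
  have {h} lt : (m < e a i)%N.
    by rewrite ltn_neqAle min // andbT eq_sym; case: h => //; rewrite aL.
  have em : ((e a i - m.+1).+1 = (e a i - m).-1.+1)%N by lia.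
  rewrite big_ltn // -{1}(subnKC lt) addSnnS exprD em.
  by rewrite exprS; ring.
move=> /PM[/(primeX (c_prime (ltnW ltil)))|]; first exact: (cy ltil).2.
move=> /(c_mono ltil); set s1 := \sum_(a in L1) _; set s2 := \sum_(a in _) _ => h.
suff : ~ c i.+1 s1.
  apply; rewrite -(addrK (y i * s2) s1); have [_ D M] := iP'; apply: D => //.
  by rewrite -mulN1r mulrCA mulrC; apply: M; exact: (cy ltil).1.
apply: IH => //; first by lia.
- by apply/set0Pn; exists a1; rewrite inE; apply/andP; split.
- by move=> a; rewrite inE => /andP[/gL].
- move=> a b; rewrite !inE => /andP[aL /eqP ea] /andP[bL /eqP eb] h'.
  apply: inj => // j /andP[]; rewrite leq_eqVlt => /orP[/eqP <- _|lt lt'].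
    by rewrite ea eb.
  by apply: h'; rewrite lt.
Qed.
End ChainIndependence.

Section Dimension.
Variables (k : fieldType) (n : nat).
Notation S := {mpoly k[n]}.

Definition box_mnm t (b : {ffun 'I_n -> 'I_t}) : 'X_{1..n} :=
  [multinom (b i : nat) | i < n].

Lemma box_mnmP t (m : 'X_{1..n}) : (forall i, m i < t)%N ->
  exists b : {ffun 'I_n -> 'I_t}, m = box_mnm b.
Proof.
move=> h; exists [ffun i => Ordinal (h i)].
by apply/mnmP => i; rewrite mnmE ffunE.
Qed.

Lemma box_mnm_inj t : injective (@box_mnm t).
Proof.
move=> a b /mnmP h; apply/ffunP => i; apply: val_inj => /=.
by have := h i; rewrite !mnmE.
Qed.

Lemma mnm_le_mdeg (m : 'X_{1..n}) i : (m i <= mdeg m)%N.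
Proof. by rewrite mdegE (bigD1 i) //= leq_addr. Qed.

Lemma msize_prodX (I : finType) (y : I -> S) (e : I -> nat) D :
  (forall i, (msize (y i) < D)%N) ->
  (msize (\prod_i y i ^+ e i) <= (D * \sum_i e i).+1)%N.
Proof.
move=> yD; have mulX i m (p : S) : (msize (y i ^+ m * p) <= D * m + msize p)%N.
  elim: m => [|m IHm]; first by rewrite mul1r muln0.
  rewrite exprS -mulrA mulnS; apply: leq_trans (msizeM_le _ _) _.
  by rewrite -addSn -addnA leq_add.
rewrite -(big_enum _ _ _ (fun i => y i ^+ e i)) -[X in (D * X)%N](big_enum _ _ _ e).
elim: (enum I) => [|i s IH]; first by rewrite !big_nil msize1.
rewrite !big_cons mulnDr -addnS; apply: leq_trans (mulX _ _ _) _.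
by rewrite leq_add2l.
Qed.

(** Products of the y i with exponents below t have coefficients supported in
a box of side proportional to t. There are t ^ l products and O (t ^ n)
coefficients, so for t large the products are linearly dependent. *)
Lemma algebraic_dependence (l : nat) (y : 'I_l -> S) : (n < l)%N ->
  exists (t : nat) (a : {ffun 'I_l -> 'I_t} -> k), (exists e, a e != 0) /\
    \sum_e a e *: \prod_i y i ^+ (e i : nat) = 0.
Proof.
(* D bounds the degrees of the y i, and E * t bounds those of the products. *)
move=> ltnl; pose D := (\max_i msize (y i)).+1.
have yD i : (msize (y i) < D)%N.
  by rewrite ltnS; apply: (leq_bigmax (F := fun i => msize (y i))).
pose E := (D * l + 1)%N; pose t := (E ^ n).+1.
have lt : (#|{ffun 'I_n -> 'I_(E * t)}| < #|{ffun 'I_l -> 'I_t}|)%N.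
  rewrite !card_ffun !card_ord expnMn.
  apply: leq_trans (leq_pexp2l _ ltnl) => //.
  by rewrite expnS ltn_pmul2r // expn_gt0.
pose f (b : {ffun 'I_n -> 'I_(E * t)}) (e : {ffun 'I_l -> 'I_t}) :=
  (\prod_i y i ^+ (e i : nat))@_(box_mnm b).
have [a [a0 af]] := exists_linear_relation f lt.
exists t, a; split => //; apply/mpolyP => m; rewrite mcoeff0 raddf_sum /=.
have [/forallP h|] := boolP [forall i, (m i < E * t)%N].
  have [b ->] := box_mnmP h; rewrite -[RHS](af b).
  by apply: eq_bigr => e _; rewrite mcoeffZ.
rewrite negb_forall => /existsP[i]; rewrite -leqNgt => le.
apply: big1 => e _; rewrite mcoeffZ memN_msupp_eq0 ?mulr0 //.
apply: msize_mdeg_ge; apply: leq_trans (msize_prodX _ yD) _.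
apply: leq_trans (leq_trans le (mnm_le_mdeg m i)).
have : (\sum_(i < l) e i <= l * t)%N.
  rewrite -[X in (X * _)%N]card_ord -sum_nat_const; apply: leq_sum => j _.
  exact: ltnW.
by rewrite /E /t; move: (\sum_i _)%N => s; nia.
Qed.

(** A relation between the y i is equal to 0, hence lies in c 0, contrary to
[chain_independent]. *)
Lemma prime_chain_dimension (P : set S) l : prime_chain_to P l -> (l <= n)%N.
Proof.
move=> [c [c_prime c_lt _]]; rewrite leqNgt; apply/negP => ltnl.
have /choice[y cy] : forall i, exists y, (i < l)%N -> c i.+1 y /\ ~ c i y.
  move=> i; have [lt|ge] := ltnP i l; last by exists 0.
  by have [_ /existsNP[y /not_implyP yP]] := c_lt i lt; exists y.
have [t [a [[e0 ae0] rel]]] := algebraic_dependence (fun i : 'I_l => y i) ltnl.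
pose e (f : {ffun 'I_l -> 'I_t}) j := if insub j is Some i then f i : nat else 0%N.
have eE f (i : 'I_l) : e f i = f i by rewrite /e valK.
pose L := [set f | a f != 0]%SET.
have pc : prime_ideal (c l) by apply: c_prime.
have [ic c1 _] := (prime_idealP _).1 pc.
apply: (@chain_independent _ l c y c_prime _ cy _ L (fun f => (a f)%:MP) e 0) => //.
- by move=> i /c_lt[].
- by apply/set0Pn; exists e0; rewrite inE.
- have [_ _ M] := ic.
  move=> f; rewrite inE => af0 /(M (a f)^-1%:MP).
  by rewrite -mpolyCM mulVf // mpolyC1.
- move=> f g _ _ h; apply/ffunP => i; apply: val_inj => /=.
  by rewrite -!eE; apply: h => /=.
- rewrite (_ : \sum_(f in L) _ = 0); last first.
    rewrite -[RHS]rel [RHS](bigID (mem L)) /= [X in _ = _ + X]big1 ?addr0.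
      apply: eq_bigr => f _; rewrite mul_mpolyC; congr (_ *: _).
      by rewrite big_mkord; apply: eq_bigr => i _; rewrite eE.
    by move=> f; rewrite inE negbK => /eqP ->; rewrite scale0r.
  by have [[? _ _] _ _] := (prime_idealP _).1 (c_prime 0 isT).
Qed.
End Dimension.

(** * Substitutions and coordinate primes *)

Section Substitution.
Variables (k : fieldType) (n : nat).
Notation S := {mpoly k[n]}.

(** Identities between substitutions are checked on constants and variables. *)
Lemma eq_mpoly_morph (R : comNzRingType) (f g : {rmorphism S -> R}) :
  (forall c, f c%:MP = g c%:MP) -> (forall i, f 'X_i = g 'X_i) -> f =1 g.
Proof.
move=> fgC fgX p; rewrite [p]mpolyE !rmorph_sum; apply: eq_bigr => m _.
rewrite -mul_mpolyC !rmorphM fgC mpolyXE_id !rmorph_prod; congr (_ * _).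
by apply: eq_bigr => i _; rewrite !rmorphXn /= fgX.
Qed.

Definition subst (h : 'I_n -> S) (p : S) : S := p \mPo [tuple h i | i < n].

HB.instance Definition _ h := GRing.isZmodMorphism.Build S S (subst h)
  (comp_mpoly_is_additive [tuple h i | i < n]).
HB.instance Definition _ h := GRing.isMonoidMorphism.Build S S (subst h)
  (rmorphism_monoidP (comp_mpoly [tuple h i | i < n])).

Lemma substC h c : subst h c%:MP = c%:MP.
Proof. exact: comp_mpolyC. Qed.

Lemma substX h i : subst h 'X_i = h i.
Proof. by rewrite /subst comp_mpolyXU -tnth_nth tnth_mktuple. Qed.

Lemma meval_subst h v p : (subst h p).@[v] = p.@[fun i => (h i).@[v]].
Proof.
by rewrite /subst comp_mpoly_meval; apply: meval_eq => i; rewrite tnth_mktuple.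
Qed.

Lemma subst_comp h g p : subst g (subst h p) = subst (fun i => subst g (h i)) p.
Proof.
by apply: (eq_mpoly_morph (f := subst g \o subst h)) p => [c|i] /=;
  rewrite ?substC // !substX.
Qed.

Lemma exists_nonroot_const (q : {poly S}) : infinite_set [set: k] -> q != 0 ->
  exists a : k, q.[a%:MP] != 0.
Proof.
move=> kinf q0; have [B _ sB] := infinite_set_fset (size q) kinf.
apply: contrapT => /forallNP h.
have : (size [seq a%:MP_[n] | a <- finmap.enum_fset B] < size q)%N.
  apply: max_poly_roots q0 _ _.
    by apply/allP => _ /mapP[a _ ->]; apply: contra_notT (h a).
  rewrite map_inj_uniq ?finmap.fset_uniq // => a b /eqP.
  by rewrite mpolyC_eq => /eqP.
by rewrite size_map ltnNge sB.
Qed.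

(** The variables are given values one at a time. At each step the current
polynomial, read as a nonzero univariate polynomial in the variable at hand
over the ring of polynomials, has finitely many roots, and k is infinite. *)
Lemma exists_nonzero_value (p : S) : infinite_set [set: k] -> p != 0 ->
  exists v : 'I_n -> k, p.@[v] != 0.
Proof.
move=> kinf p0.
suff [v h] : exists v : 'I_n -> k,
    subst (fun i => if i \in enum 'I_n then (v i)%:MP else 'X_i) p != 0.
  exists v; apply: contraNneq h => pv; apply/eqP.
  have e : subst (fun i => if i \in enum 'I_n then (v i)%:MP else 'X_i) =1
      @mpolyC n k \o meval v.
    apply: eq_mpoly_morph => [c|i] /=; first by rewrite substC mevalC.
    by rewrite substX mevalXU mem_enum.
  by rewrite e /= pv mpolyC0.
elim: (enum 'I_n) (enum_uniq 'I_n) => [_|i s IH /andP[iNs /IH[v {}IH]]].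
  exists (fun=> 0); have e : subst (fun i => 'X_i) =1 (@idfun S).
    by apply: eq_mpoly_morph => [c|i] /=; rewrite ?substC ?substX.
  by rewrite [subst _ p]e.
set q := subst _ p in IH.
(* Q is q with the variable i replaced by a new polynomial variable. *)
pose g j : {poly S} := if j == i then 'X else ('X_j)%:P.
pose Q := mmap (polyC \o @mpolyC n k) g q.
have hQ (r : S) : Q.[r] = subst (fun j => if j == i then r else 'X_j) q.
  have e : horner_eval r \o mmap (polyC \o @mpolyC n k) g =1
      subst (fun j => if j == i then r else 'X_j).
    apply: eq_mpoly_morph => [c|j] /=.
      by rewrite /horner_eval mmapC /= hornerC substC.
    rewrite /horner_eval mmapX mmap1U substX /g.
    by case: ifP => _; rewrite ?hornerX ?hornerC.
  exact: e.
have Q0 : Q != 0.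
  apply: contraNneq IH => Q0; have e : idfun =1
      subst (fun j => if j == i then 'X_i else 'X_j : S).
    apply: eq_mpoly_morph => [c|j] /=; first by rewrite substC.
    by rewrite substX; case: eqP => [->|].
  by rewrite [q]e -hQ Q0 horner0.
have [a] := exists_nonroot_const kinf Q0; rewrite hQ subst_comp => h.
exists (fun j => if j == i then a else v j).
set h1 := (X in subst X p) in h; set h2 := (X in subst X p).
have -> // : h2 = h1; apply/funext => j; rewrite /h1 /h2 inE.
have [->|ji] := eqVneq j i.
  by rewrite (negbTE iNs) substX eqxx.
by case: ifP => _; rewrite ?substC // substX (negbTE ji).
Qed.

End Substitution.

Section CoordinatePrimes.
Variables (k : fieldType) (n : nat).
Notation S := {mpoly k[n]}.
Implicit Types A B : {set 'I_n}.

Definition kill A : S -> S := subst (fun i => if i \in A then 0 else 'X_i).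

HB.instance Definition _ A := GRing.isZmodMorphism.Build S S (kill A)
  (raddfB (subst (fun i => if i \in A then 0 else 'X_i))).
HB.instance Definition _ A := GRing.isMonoidMorphism.Build S S (kill A)
  (rmorphism_monoidP (subst (fun i => if i \in A then 0 else 'X_i))).

(** Kernel of a substitution: this makes primality immediate. That it is the
ideal generated by the variables in A is [coord_prime_min]. *)
Definition coord_prime A : set S := [set p | kill A p = 0].

Lemma killX A i : kill A 'X_i = if i \in A then 0 else 'X_i.
Proof. exact: substX. Qed.

Lemma killC A c : kill A c%:MP = c%:MP.
Proof. exact: substC. Qed.

Lemma kill_kill A B p : A \subset B -> kill B (kill A p) = kill B p.
Proof.
move=> /fintype.subsetP AB.
have e : kill B \o kill A =1 kill B; last exact: e.
apply: eq_mpoly_morph => [c|i] /=; first by rewrite !killC.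
rewrite !killX; have [/AB ->|_] := boolP (i \in A); first exact: rmorph0.
exact: killX.
Qed.

Lemma coord_prime_prime A : prime_ideal (coord_prime A).
Proof.
apply/prime_idealP; split; first split.
- exact: rmorph0.
- by move=> u v; rewrite /coord_prime /= rmorphD /= => -> ->; rewrite addr0.
- by move=> u v; rewrite /coord_prime /= rmorphM /= => ->; rewrite mulr0.
- by rewrite /coord_prime /= rmorph1 => /eqP; rewrite oner_eq0.
- move=> u v; rewrite /coord_prime /= rmorphM => /eqP.
  by rewrite mulf_eq0 => /orP[] /eqP; [left|right].
Qed.

Lemma coord_prime_mono A B : A \subset B -> coord_prime A `<=` coord_prime B.
Proof. by move=> AB p pA; rewrite /coord_prime /= -(kill_kill p AB) pA rmorph0. Qed.

Lemma coord_primeX A i : coord_prime A 'X_i <-> i \in A.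
Proof.
rewrite /coord_prime /= killX; case: ifP => // _; split=> // /mpolyP/(_ U_(i)%MM).
by rewrite mcoeffXU eqxx mcoeff0 => /eqP; rewrite oner_eq0.
Qed.

Lemma coord_prime_proper A B : A \proper B -> coord_prime A `<` coord_prime B.
Proof.
move=> /properP[AB [i iB iA]]; split; first exact: coord_prime_mono.
by move=> BA; move/negP: iA; apply; apply/coord_primeX/BA/coord_primeX.
Qed.

Lemma coord_prime_irrelevant A :
  coord_prime A `<=` irrelevant_ideal (n := n) (k := k).
Proof.
move=> p pA; apply/irrelevant_idealP; have := congr1 (meval (fun=> 0)) pA.
rewrite meval_subst meval0 => h; rewrite -[RHS]h; apply: meval_eq => i.
by case: ifP => _; rewrite ?meval0 ?mevalXU.
Qed.

(** Setting the variables of A to zero does not change p modulo J. *)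
Lemma coord_prime_min A (J : set S) : is_ideal J ->
  (forall i, i \in A -> J 'X_i) -> coord_prime A `<=` J.
Proof.
move=> iJ AJ p pA; have [J0 JD JM] := iJ.
suff : J (p - kill A p) by rewrite pA subr0.
elim/mpolyind: p {pA} => [|c m p _ _ IH]; first by rewrite rmorph0 subr0.
rewrite rmorphD opprD addrACA; apply: (JD) => //.
rewrite -mul_mpolyC rmorphM /= killC -mulrBr; apply: (JM).
rewrite mpolyXE_id rmorph_prod.
have [/existsP[i /andP[iA mi]]|/existsPn h] :=
    boolP [exists i, (i \in A) && (m i != 0%N)].
  rewrite [X in _ - X](bigD1 i) //= rmorphXn /= killX iA.
  rewrite expr0n (negbTE mi) mul0r subr0 (bigD1 i) //= mulrC.
  rewrite -(prednK (n := m i)) ?lt0n // exprSr mulrA; apply: (JM).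
  exact: AJ.
rewrite [X in _ - X](_ : _ = \prod_(i < n) 'X_i ^+ m i) ?subrr //.
apply: eq_bigr => i _; rewrite rmorphXn /= killX; case: ifP => // iA.
by have := h i; rewrite iA negbK => /eqP ->; rewrite !expr0.
Qed.

Lemma coord_prime_chain A l d B : A \subset B -> #|B :\: A| = d ->
  prime_chain_to (coord_prime A) l -> prime_chain_to (coord_prime B) (l + d).
Proof.
elim: d B => [|d IH] B AB.
  move/eqP; rewrite cards_eq0 finset.setD_eq0 => BA; rewrite addn0.
  by have -> : A = B by apply/eqP; rewrite finset.eqEsubset AB.
move=> cB hA; have /card_gt0P[i iBA] : (0 < #|B :\: A|)%N by rewrite cB.
move: (iBA); rewrite inE => /andP[iA iB].
rewrite addnS; apply: (@prime_chain_extend _ (coord_prime (B :\ i))).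
- apply: IH => //.
    apply/fintype.subsetP => j jA; rewrite !inE (fintype.subsetP AB) // andbT.
    by apply: contraNneq iA => <-.
  have -> : (B :\ i :\: A = (B :\: A) :\ i)%SET.
    by rewrite !finset.setDDl finset.setUC.
  by move: cB; rewrite (cardsD1 i) iBA => -[].
- exact: coord_prime_prime.
- exact/coord_prime_proper/properD1.
Qed.

Lemma coord_prime_chain_card A : prime_chain_to (coord_prime A) #|A|.
Proof.
apply: (@coord_prime_chain finset.set0 0); rewrite ?finset.sub0set ?finset.setD0 //.
exists (fun=> coord_prime finset.set0); split=> // *; exact: coord_prime_prime.
Qed.

(** A longer chain would, once prolonged through the coordinate primes
between A and the full set of indices, exceed the dimension n. *)
Lemma coord_prime_height A l :
  prime_chain_to (coord_prime A) l -> (l <= #|A|)%N.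
Proof.
move/(coord_prime_chain (finset.subsetT A) erefl)/prime_chain_dimension.
by rewrite finset.setTD; have := cardsC A; rewrite card_ord; lia.
Qed.

End CoordinatePrimes.

(** * The number of generators of a coordinate prime up to radical *)

Section Generators.
Variables (k : fieldType) (n : nat).
Notation S := {mpoly k[n]}.
Implicit Types p q : S.

(** The t-th power of the ideal generated by the variables, described by
coefficients. *)
Definition order_ge t : set S := [set p | forall m, (mdeg m < t)%N -> p@_m = 0].

Lemma order_ge_mul a b p q :
  order_ge a p -> order_ge b q -> order_ge (a + b) (p * q).
Proof.
move=> pa qb m lt; apply/eqP; rewrite mcoeff_eq0; apply/negP => /msuppM_le.
case/allpairsP => -[m1 m2] /= [m1p m2q em]; move: lt; rewrite em mdegD.
move: m1p m2q; rewrite !mcoeff_msupp; have [/pa->|le1] := ltnP (mdeg m1) a.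
  by rewrite eqxx.
have [/qb->|le2 _ _] := ltnP (mdeg m2) b; first by rewrite eqxx.
by rewrite ltnNge leq_add.
Qed.

Lemma order_ge0 p : order_ge 0 p.
Proof. by []. Qed.

Lemma order_ge_ideal t : is_ideal (order_ge t).
Proof.
split=> [m _|u v ut vt m lt|u v vt]; first by rewrite mcoeff0.
  by rewrite mcoeffD ut // vt // addr0.
exact: (order_ge_mul (@order_ge0 u) vt).
Qed.

Lemma order_ge1 p : p.@[fun=> 0] = 0 -> order_ge 1 p.
Proof.
move/irrelevant_idealP; apply: ideal_gen_min; first exact: order_ge_ideal.
move=> _ [i _ <-] m; rewrite ltnS leqn0 mdeg_eq0 => /eqP ->.
by rewrite mcoeffX mnm1_eq0.
Qed.

Lemma order_geX t p e : order_ge t p -> order_ge (t * e) (p ^+ e).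
Proof.
move=> pt; elim: e => [|e IH]; first by rewrite muln0.
by rewrite exprS mulnS; apply: order_ge_mul.
Qed.

Lemma order_ge_prodX (T : finType) (r : T -> S) (e : T -> nat) :
  (forall j, order_ge 1 (r j)) -> order_ge (\sum_j e j) (\prod_j r j ^+ e j).
Proof.
move=> r1; apply: (big_ind2 (fun s p => order_ge s p)) => //.
  by move=> a p b q; apply: order_ge_mul.
by move=> j _; have := order_geX (e := e j) (r1 j); rewrite mul1n.
Qed.

(** Near the origin, every polynomial is a combination of products of a
monomial with exponents below N and a monomial in the r j, modulo polynomials
of order t. For t proportional to q there are O (q ^ #|T|) such products of
order less than t, whereas there are q ^ n monomials with exponents below q.
If #|T| < n, some nonzero functional L on the coefficients of these monomials
kills all the products, for q large; but then it kills all polynomials. *)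
Lemma primary_generators_ge (T : finType) (r : T -> S) (s : S) N :
  (forall j, (r j).@[fun=> 0] = 0) -> s.@[fun=> 0] != 0 ->
  (forall i, ideal_gen (range r) (s * 'X_i ^+ N)) -> (n <= #|T|)%N.
Proof.
move=> r0 s0 sX; rewrite leqNgt; apply/negP => ltTn.
have r1 j : order_ge 1 (r j) by apply: order_ge1.
(* With this q the number N ^ n * t ^ #|T| of products is less than q ^ n, and
   monomials with exponents below q have degree less than t. *)
pose q := (N ^ n * n ^ #|T|).+1; pose t := (n * q)%N.
pose mon (A : {ffun 'I_n -> 'I_N} * {ffun T -> 'I_t}) : S :=
  'X_[box_mnm A.1] * \prod_j r j ^+ (A.2 j : nat).
have lt : (#|{: {ffun 'I_n -> 'I_N} * {ffun T -> 'I_t}}| <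
           #|{ffun 'I_n -> 'I_q}|)%N.
  rewrite card_prod !card_ffun !card_ord /t expnMn mulnA.
  apply: leq_trans (leq_pexp2l _ ltTn) => //.
  by rewrite expnS ltn_pmul2r // expn_gt0.
have [a [[b0 ab0] arel]] :=
  exists_linear_relation (fun A b => (mon A)@_(box_mnm b)) lt.
pose L p := \sum_b a b * p@_(box_mnm b).
have LD p p' : L (p + p') = L p + L p'.
  by rewrite /L -big_split; apply: eq_bigr => b _; rewrite mcoeffD mulrDr.
have LZ c p : L (c *: p) = c * L p.
  by rewrite /L mulr_sumr; apply: eq_bigr => b _; rewrite mcoeffZ mulrCA.
have Lord p : order_ge t p -> L p = 0.
  move=> pt; apply: big1 => b _; rewrite pt ?mulr0 //.
  rewrite mdegE; apply: leq_ltn_trans (_ : n * q.-1 < _)%N.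
    rewrite -[X in (X * _)%N]card_ord -sum_nat_const; apply: leq_sum => i _.
    by rewrite mnmE -ltnS prednK.
  by rewrite ltn_pmul2l // (leq_ltn_trans _ ltTn).
(* Up to a unit s = 1 - w with w of positive order; 1 - w ^ t is a multiple of
   1 - w, so that s is invertible modulo order t. *)
have Xr i : exists2 z, order_ge t z & ideal_gen (range r) ('X_i ^+ N - z).
  pose w := 1 - (s.@[fun=> 0])^-1%:MP * s.
  have w1 : order_ge 1 w.
    by apply: order_ge1; rewrite mevalB meval1 mevalM mevalC mulVf ?subrr.
  exists ('X_i ^+ N * w ^+ t).
    have [_ _ M] := order_ge_ideal t; apply: M.
    by have := order_geX (e := t) w1; rewrite mul1n.
  have -> : 'X_i ^+ N - 'X_i ^+ N * w ^+ t =
    (\sum_(j < t) w ^+ j * (s.@[fun=> 0])^-1%:MP) * (s * 'X_i ^+ N).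
    have := subrX1 w t; rewrite -mulr_suml /w => e.
    rewrite -{1}['X_i ^+ N]mulr1 -mulrBr -opprB e; ring.
  exact: ideal_genM.
(* Products of the r j of degree at least t have order t. Below that degree, an
   exponent of x_i that is at least N is traded for one more factor r j. *)
have main d (e : T -> nat) p :
    (t <= \sum_j e j + d)%N -> L (p * \prod_j r j ^+ e j) = 0.
  elim: d => [|d IH] in e p *.
    rewrite addn0 => le; apply: Lord => m /leq_trans/(_ le) lt'.
    exact: (order_ge_mul (@order_ge0 p) (order_ge_prodX (e := e) r1) lt').
  rewrite addnS => le; elim/mpolyind: p => [|c m p _ _ IHp].
    rewrite mul0r; apply: Lord; by have [] := order_ge_ideal t.
  rewrite mulrDl LD IHp addr0 -scalerAl LZ (_ : L _ = 0) ?mulr0 //.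
  have [lte|h] := ltnP (\sum_j e j) t; last first.
    by apply: IH; apply: leq_trans h (leq_addr _ _).
  have [/forallP/box_mnmP[b ->]|/forallPn[i]] := boolP [forall i, (m i < N)%N].
    have et j : (e j < t)%N.
      by apply: leq_ltn_trans lte; rewrite (bigD1 j) //= leq_addr.
    have := arel (b, [ffun j => Ordinal (et j)]).
    rewrite /mon /= => h; rewrite -[RHS]h; congr (L (_ * _)).
    by apply: eq_bigr => j _; rewrite ffunE.
  rewrite -leqNgt => leN; have [z zt ziX] := Xr i.
  have -> : 'X_[m] = 'X_[(m - U_(i) *+ N)%MM] * (('X_i ^+ N - z) + z) :> S.
    rewrite subrK mpolyXn -mpolyXD submK //; apply/mnm_lepP => j.
    rewrite mulmnE mnm1E; case: eqP => [<-|_]; last by rewrite mul0n.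
    by rewrite mul1n.
  rewrite mulrDr mulrDl LD [X in _ + X]Lord ?addr0; last first.
    have [_ _ M] := order_ge_ideal t; rewrite mulrAC; exact: M.
  pose J := [set g : S | forall u, L (u * g * \prod_j r j ^+ e j) = 0].
  suff : ideal_gen (range r) `<=` J by apply.
  apply: ideal_gen_min; first split=> [u|u v Ju Jv p'|u v Jv p'].
  - rewrite mulr0 mul0r; apply: Lord; by have [] := order_ge_ideal t.
  - by rewrite mulrDr mulrDl LD Ju Jv addr0.
  - by rewrite mulrA.
  move=> _ [j0 _ <-] u.
  have -> : u * r j0 * \prod_j r j ^+ e j = u * \prod_j r j ^+ (e j + (j == j0)).
    rewrite -mulrA; congr (_ * _); rewrite [RHS](bigD1 j0) //= eqxx addn1 exprS.
    rewrite (bigD1 j0) //= mulrA; congr (_ * _).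
    by apply: eq_bigr => j /negbTE ->; rewrite addn0.
  apply: IH; rewrite big_split /= [X in (_ + X + _)%N](bigD1 j0) //= eqxx; lia.
have := main t (fun=> 0%N) 'X_[box_mnm b0] (leq_addl _ _).
rewrite big1 ?mulr1 => [|j _]; last by rewrite expr0.
rewrite /L (bigD1 b0) //= mcoeffX eqxx mulr1 big1 ?addr0 => [/eqP|b bb0].
  by rewrite (negbTE ab0).
rewrite mcoeffX (inj_eq (@box_mnm_inj _ _)) eq_sym (negbTE bb0).
by rewrite mulr0.
Qed.

(** Translate to the origin a point v with coordinates zero in A at which s
does not vanish, and add the variables outside A to the translated a j: the
resulting l + (n - #|A|) polynomials satisfy the hypotheses of
[primary_generators_ge]. *)
Lemma coord_prime_generators_ge A l (a : 'I_l -> S) (s : S) N :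
  infinite_set [set: k] -> (forall j, coord_prime A (a j)) -> ~ coord_prime A s ->
  (forall i, i \in A -> ideal_gen (range a) (s * 'X_i ^+ N)) -> (#|A| <= l)%N.
Proof.
move=> kinf aA sA sX.
have [v sv] := exists_nonzero_value kinf (introN eqP sA).
pose tau := subst (fun i : 'I_n => if i \in A then 'X_i else 'X_i + (v i)%:MP : S).
have tau0 p : (tau p).@[fun=> 0] = (kill A p).@[v].
  rewrite !meval_subst; apply: meval_eq => i; case: ifP => _.
    by rewrite mevalXU meval0.
  by rewrite mevalD mevalC !mevalXU add0r.
pose r (j : 'I_l + {j | j \notin A}) : S :=
  match j with inl j => tau (a j) | inr j => 'X_(val j) end.
have : (n <= #|{: 'I_l + {j | j \notin A}}|)%N.
  apply: (@primary_generators_ge _ r (tau s) N.+1) => [[j|j]||i] /=.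
  - by rewrite tau0 aA meval0.
  - by rewrite mevalXU.
  - by rewrite tau0.
  have [iA|iA] := boolP (i \in A).
    have : [set p | ideal_gen (range r) (tau p)] (s * 'X_i ^+ N).
      move: (sX i iA); apply: ideal_gen_min.
        split=> [|u w|u w] /=; rewrite /tau ?rmorph0 ?rmorphD ?rmorphM /=.
        - exact: ideal_gen0.
        - exact: ideal_genD.
        - exact: ideal_genM.
      by move=> _ [j _ <-]; apply: sub_ideal_gen; exists (inl j).
    rewrite /= /tau rmorphM rmorphXn /= substX iA exprS mulrCA; exact: ideal_genM.
  rewrite exprSr mulrA; apply: ideal_genM; apply: sub_ideal_gen.
  by exists (inr (exist _ i iA)).
rewrite card_sum card_ord card_sig; have := cardC A; rewrite card_ord.
rewrite (eq_card (_ : [pred j | j \notin A] =i [predC A])) //; lia.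
Qed.

End Generators.

(** * Primes of a localization *)

Section LocalizationPrimes.
Variables (R : idomainType) (P : set R) (pP : prime_ideal P).
Notation RP := (localization pP).
Implicit Types (Q : set R) (C : set RP).

Lemma to_loc_is_zmod_morphism : zmod_morphism (to_loc pP).
Proof. by move=> a b; apply: val_inj; rewrite rmorphB /= rmorphB. Qed.

Lemma to_loc_is_monoid_morphism : monoid_morphism (to_loc pP).
Proof.
split; first by apply: val_inj; rewrite rmorph1 /= rmorph1.
by move=> a b; apply: val_inj; rewrite rmorphM /= rmorphM.
Qed.

HB.instance Definition _ := GRing.isZmodMorphism.Build R RP (to_loc pP)
  to_loc_is_zmod_morphism.
HB.instance Definition _ := GRing.isMonoidMorphism.Build R RP (to_loc pP)
  to_loc_is_monoid_morphism.

Lemma to_loc_inj : injective (to_loc pP).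
Proof. by move=> a b /(congr1 val) /= /eqP; rewrite tofrac_eq => /eqP. Qed.

Lemma loc_fraction (x : RP) : exists a b, ~ P b /\ to_loc pP b * x = to_loc pP a.
Proof.
have [a [b [Pb xE]]] := loc_predP _ _ (valP x); exists a, b; split=> //.
apply: val_inj; rewrite rmorphM /= [loc_val x]xE mulrC divfK //.
by rewrite tofrac_eq0 (prime_ideal_neq0 pP).
Qed.

Lemma to_loc_unit b : ~ P b -> exists y : RP, y * to_loc pP b = 1.
Proof.
move=> Pb; have y_loc : tofrac 1 / tofrac b \in loc_pred pP.
  by apply/loc_predP; exists 1, b.
exists (Localization y_loc); apply: val_inj; rewrite rmorphM /= divfK.
  by rewrite !rmorph1.
by rewrite tofrac_eq0 (prime_ideal_neq0 pP).
Qed.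

(** The extension of Q, described by its fractions a / b rather than by
generators: that it is prime and contracts to Q is then a computation. *)
Definition loc_prime Q : set RP :=
  [set x | exists a b, [/\ ~ P b, Q a & to_loc pP b * x = to_loc pP a]].

Definition contraction C : set R := [set a | C (to_loc pP a)].

Lemma prime_not_unit C b : prime_ideal C -> ~ P b -> ~ C (to_loc pP b).
Proof.
move=> /prime_idealP[[_ _ CM] C1 _] /to_loc_unit[y yb] Cb.
by apply: C1; rewrite -yb; apply: CM.
Qed.

Lemma contraction_fraction C x a b : prime_ideal C -> ~ P b ->
  to_loc pP b * x = to_loc pP a -> contraction C a <-> C x.
Proof.
move=> pC Pb e; rewrite /contraction /= -e.
have /prime_idealP[[_ _ CM] _ Cp] := pC.
by split=> [/Cp[/(prime_not_unit pC Pb)|]|/CM].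
Qed.

Lemma contraction_prime C : prime_ideal C -> prime_ideal (contraction C).
Proof.
move=> /prime_idealP[[C0 CD CM] C1 Cp]; apply/prime_idealP; rewrite /contraction /=.
split; [split|by rewrite /= rmorph1|by move=> u v; rewrite /= rmorphM; apply: Cp].
- by rewrite /= rmorph0.
- by move=> u v; rewrite /= rmorphD; apply: CD.
- by move=> u v; rewrite /= rmorphM; apply: CM.
Qed.

(** Strictness survives because a prime of the localization contains a
fraction exactly when it contains its numerator. *)
Lemma contraction_chain C h :
  prime_chain_to C h -> prime_chain_to (contraction C) h.
Proof.
move=> [c [pc cc <-]]; exists (fun i => contraction (c i)); split=> // i lt.
  exact/contraction_prime/pc.
have [sub nsub] := cc i lt; split=> [a /sub//|h']; apply: nsub => x.
have [a [b [Pb e]]] := loc_fraction x.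
rewrite -(contraction_fraction (pc _ lt) Pb e).
rewrite -(contraction_fraction (pc _ (ltnW lt)) Pb e).
exact: h'.
Qed.

Lemma loc_prime_contraction Q :
  prime_ideal Q -> Q `<=` P -> contraction (loc_prime Q) = Q.
Proof.
move=> pQ QP; apply/seteqP; split=> a; rewrite /contraction /loc_prime /=.
  move=> [a' [b [Pb Qa']]]; rewrite -rmorphM => /to_loc_inj e.
  have /prime_idealP[_ _ Qp] := pQ.
  by move: Qa'; rewrite -e => /Qp[/QP|].
move=> Qa; exists a, 1; split=> //; first exact: prime_ideal1.
by rewrite rmorph1 mul1r.
Qed.

Lemma loc_prime_prime Q : prime_ideal Q -> Q `<=` P -> prime_ideal (loc_prime Q).
Proof.
move=> pQ QP; have /prime_idealP[[Q0 QD QM] Q1 Qp] := pQ.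
have PM := prime_idealMN pP; apply/prime_idealP; split; first split.
- exists 0, 1; split=> //; first exact: prime_ideal1.
  by rewrite rmorph0 mulr0.
- move=> u v [a [b [Pb Qa e]]] [a' [b' [Pb' Qa' e']]].
  exists (b' * a + b * a'), (b * b'); split; first exact: PM.
    by apply: QD; apply: QM.
  by rewrite rmorphD !rmorphM /= -e -e'; ring.
- move=> u v [a [b [Pb Qa e]]]; have [a' [b' [Pb' e']]] := loc_fraction u.
  exists (a' * a), (b * b'); split; [exact: PM|exact: QM|].
  by rewrite !rmorphM /= -e -e'; ring.
- have -> : (1 : RP) = to_loc pP 1 by rewrite rmorph1.
  by move=> h; apply: Q1; rewrite -(loc_prime_contraction pQ QP).
- move=> u v [a [b [Pb Qa e]]].
  have [a1 [b1 [Pb1 e1]]] := loc_fraction u.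
  have [a2 [b2 [Pb2 e2]]] := loc_fraction v.
  have : Q (b * a1 * a2).
    have -> : b * a1 * a2 = b1 * b2 * a; last exact: QM.
    by apply: to_loc_inj; rewrite !rmorphM /= -e -e1 -e2; ring.
  case/Qp => [/Qp[/QP//|Qa1]|Qa2]; first by left; exists a1, b1.
  by right; exists a2, b2.
Qed.

Lemma loc_prime_min Q C :
  prime_ideal C -> Q `<=` contraction C -> loc_prime Q `<=` C.
Proof.
move=> pC QC x [a [b [Pb /QC Ca e]]].
exact: (contraction_fraction pC Pb e).1.
Qed.

Lemma loc_prime_chain Q h : Q `<=` P -> prime_chain_to Q h ->
  prime_chain_to (loc_prime Q) h.
Proof.
elim: h Q => [|h IH] Q QP [c [pc cc ch]].
  have pQ : prime_ideal Q by rewrite -ch; apply: pc.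
  by exists (fun=> loc_prime Q); split=> // i _; apply: loc_prime_prime.
have pQ : prime_ideal Q by rewrite -ch; apply: pc.
have [sub nsub] := cc h (ltnSn h); rewrite ch in sub nsub.
have phQ := subset_trans sub QP.
apply: prime_chain_extend (loc_prime_prime pQ QP) _.
  apply: (IH (c h) phQ); exists c; split=> // i lt; first exact: pc (leqW _).
  exact: cc (leqW _).
split=> [x [a [b [Pb /sub Qa e]]]|h']; first by exists a, b.
apply: nsub => a; rewrite -{1}(loc_prime_contraction pQ QP).
by rewrite -(loc_prime_contraction (pc h (leqnSn h)) phQ) => /h'.
Qed.

Lemma loc_ideal_sub C (I : set R) :
  is_ideal C -> I `<=` contraction C -> loc_ideal pP I `<=` C.
Proof. by move=> iC IC; apply: ideal_gen_min => // _ [a /IC ? <-]. Qed.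

Lemma sub_loc_ideal (I : set R) a : I a -> loc_ideal pP I (to_loc pP a).
Proof. by move=> Ia; apply: sub_ideal_gen; exists a. Qed.

(** Elements with a multiple, by some u outside P, in the ideal generated by
the numerators form an ideal of the localization. *)
Lemma clear_denominators (T : Type) (r : T -> RP) (a b : T -> R) x :
  (forall j, ~ P (b j)) -> (forall j, to_loc pP (b j) * r j = to_loc pP (a j)) ->
  ideal_gen (range r) x ->
  exists u p, [/\ ~ P u, ideal_gen (range a) p & to_loc pP u * x = to_loc pP p].
Proof.
move=> Pb rE; have PM := prime_idealMN pP.
pose J := [set x : RP | exists u p,
  [/\ ~ P u, ideal_gen (range a) p & to_loc pP u * x = to_loc pP p]].
suff : ideal_gen (range r) `<=` J by apply.
apply: ideal_gen_min => [|_ [j _ <-]]; last first.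
  by exists (b j), (a j); split=> //; apply: sub_ideal_gen; exists j.
split=> [|y z|y z].
- exists 1, 0; split; [exact: prime_ideal1|exact: ideal_gen0|].
  by rewrite rmorph0 mulr0.
- move=> [u [p [Pu gp e]]] [v [q [Pv gq e']]].
  exists (u * v), (v * p + u * q); split; first exact: PM.
    by apply: ideal_genD; apply: ideal_genM.
  by rewrite rmorphD !rmorphM /= -e -e'; ring.
- move=> [v [q [Pv gq e']]]; have [c [d [Pd e]]] := loc_fraction y.
  exists (d * v), (c * q); split; [exact: PM|exact: ideal_genM|].
  by rewrite !rmorphM /= -e -e'; ring.
Qed.

End LocalizationPrimes.

Arguments loc_prime {R P} pP Q.
Arguments loc_prime_prime {R P} pP {Q}.
Arguments loc_prime_contraction {R P} pP {Q}.
Arguments sub_loc_ideal {R P} pP {I a}.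
Arguments loc_prime_chain {R P} pP {Q h}.

(** * Stanley-Reisner ideals of matroids *)

Section StanleyReisner.
Variables (k : fieldType) (n : nat) (Delta : {set {set 'I_n}}).
Hypothesis mD : is_matroid Delta.
Notation S := {mpoly k[n]}.
Notation mP := (irrelevant_ideal_prime k n).
Notation I := (Stanley_Reisner k Delta).
Implicit Types (F G : {set 'I_n}).

Lemma Stanley_Reisner_sub G : facet Delta G -> I `<=` coord_prime (~: G).
Proof.
move=> fG; have /prime_idealP[iC _ _] := coord_prime_prime k (~: G).
apply: ideal_gen_min => // _ [F FD ->].
have /fintype.subsetPn[i iF iG] : ~~ (F \subset G).
  by apply: contra FD => FG; apply: face_sub FG => //; apply: facet_face.
rewrite (bigD1 i) //= mulrC; have [_ _ M] := iC; apply: M.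
by apply/coord_primeX; rewrite inE.
Qed.

Lemma facet_addN G i : facet Delta G -> i \notin G -> i |: G \notin Delta.
Proof.
move=> /maxsetP[_ mG] iG; apply/negP => /mG/(_ (finset.subsetUr _ _)) e.
by move: iG; rewrite -e !inE eqxx.
Qed.

(** The variables outside p have their product outside p, so their indices
form a face; p contains all variables outside any facet through that face. *)
Lemma prime_over_Stanley_Reisner (p : set S) : prime_ideal p -> I `<=` p ->
  exists2 G, facet Delta G & coord_prime (~: G) `<=` p.
Proof.
move=> pp Ip; pose F := [set i | `[< ~ p 'X_i >]]%SET.
have FD : F \in Delta.
  apply/negPn/negP => FD.
  have : p (\prod_(i in F) 'X_i) by apply/Ip/sub_ideal_gen; exists F.
  by case/(prime_prod pp) => i; rewrite inE => /asboolP.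
have [G fG FG] := face_facet FD; exists G => //.
have /prime_idealP[ip _ _] := pp; apply: coord_prime_min => // i.
rewrite inE => iG; apply: contrapT => pi; move: iG.
by rewrite (fintype.subsetP FG) // inE; apply/asboolP.
Qed.

(** A prime over the ideal contains the extension of a coordinate prime, and
all the coordinate primes involved have the same height because the facets have
the same size. *)
Lemma Stanley_Reisner_height G : facet Delta G ->
  has_height (loc_ideal mP I) #|~: G|.
Proof.
move=> fG; split.
  exists (loc_prime mP (coord_prime (~: G))).
  have pA := coord_prime_prime k (~: G).
  have pC := loc_prime_prime mP pA (@coord_prime_irrelevant k n _).
  have cE := loc_prime_contraction mP pA (@coord_prime_irrelevant k n _).
  split=> //.
    apply: loc_ideal_sub; first by have /prime_idealP[] := pC.
    by rewrite cE; apply: Stanley_Reisner_sub.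
  split=> [|h /contraction_chain]; last by rewrite cE; apply: coord_prime_height.
  apply: (loc_prime_chain mP (@coord_prime_irrelevant k n _)).
  exact: coord_prime_chain_card.
move=> C h pC IC [_ hC].
have [G' fG' sub] : exists2 G', facet Delta G' &
    coord_prime (~: G') `<=` contraction C.
  apply: prime_over_Stanley_Reisner (contraction_prime pC) _.
  by move=> a /(sub_loc_ideal mP) /IC.
have -> : #|~: G| = #|~: G'|.
  by apply/eqP; rewrite -(eqn_add2l #|G|) cardsC (facet_card mD fG fG') cardsC.
apply: hC; apply: prime_chain_enlarge pC (loc_prime_min pC sub).
apply: (loc_prime_chain mP (@coord_prime_irrelevant k n _)).
exact: coord_prime_chain_card.
Qed.

(** The generators are the cyclic sums of positive nullity. *)
Lemma Stanley_Reisner_generated G : facet Delta G ->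
  radically_generated (loc_ideal mP I) #|~: G|.
Proof.
move=> fG; pose f j : S := cyclic_sum Delta (fun i => 'X_i) j.
(* The nullities of non-faces range from 1 to h, whence the shift. *)
exists (fun j => to_loc mP (f j.+1)).
set r := fun _ => _; have iR : is_ideal (radical (ideal_gen (range r))).
  exact/radical_is_ideal/ideal_gen_is_ideal.
apply/seteqP; split; apply: radical_min.
  apply: ideal_gen_min; first exact/radical_is_ideal/ideal_gen_is_ideal.
  move=> _ [j _ <-]; apply/sub_radical/sub_loc_ideal.
  apply: ideal_sum => [|C /andP[_ /eqP jC]]; first exact: ideal_gen_is_ideal.
  by apply: sub_ideal_gen; exists C; rewrite // -nullity_gt0 // jC.
apply: loc_ideal_sub => // ; apply: ideal_gen_min.
  have [J0 JD JM] := iR; split.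
  - by rewrite /contraction /= rmorph0.
  - by move=> u v; rewrite /contraction /= rmorphD; apply: JD.
  - by move=> u v; rewrite /contraction /= rmorphM; apply: JM.
move=> _ [C CD ->]; rewrite /contraction /= rmorph_prod.
apply: (Schmitt_Vogel mD iR (h := #|~: G|)) CD => [x|D|j /andP[j0 jh]].
- exact: radicalX.
- by rewrite -(nullityT mD fG); apply/nullity_mono/finset.subsetT.
apply/sub_radical/sub_ideal_gen.
have jh' : (j.-1 < #|~: G|)%N by rewrite prednK.
exists (Ordinal jh') => //=; rewrite /r /= prednK // rmorph_sum.
by apply: eq_bigr => D _; rewrite rmorph_prod.
Qed.

(** For i outside G, the product g of the variables in G times x_i is a
generator of the Stanley-Reisner ideal, so a power of it lies in the ideal
generated by the given elements. Clearing denominators turns this into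
a relation s x_i ^ N in (a_1, ..., a_l) with s = u g ^ N outside the coordinate
prime of the complement of G. *)
Lemma Stanley_Reisner_ara_ge G l : infinite_set [set: k] -> facet Delta G ->
  radically_generated (loc_ideal mP I) l -> (#|~: G| <= l)%N.
Proof.
move=> kinf fG [r rE]; set A := ~: G.
have pA := coord_prime_prime k A; have Am := @coord_prime_irrelevant k n A.
have /choice[ab abP] : forall j, exists ab : S * S,
    ~ irrelevant_ideal ab.2 /\ to_loc mP ab.2 * r j = to_loc mP ab.1.
  by move=> j; have [a [b h]] := loc_fraction (r j); exists (a, b).
pose a j := (ab j).1.
have aA j : coord_prime A (a j).
  have pC := loc_prime_prime mP pA Am.
  rewrite -(loc_prime_contraction mP pA Am).
  apply/(contraction_fraction pC (abP j).1 (abP j).2).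
  suff : radical (loc_ideal mP I) `<=` loc_prime mP (coord_prime A).
    by apply; rewrite -rE; apply/sub_radical/sub_ideal_gen; exists j.
  apply: radical_prime_sub => //; apply: loc_ideal_sub.
    by have /prime_idealP[] := pC.
  by rewrite loc_prime_contraction //; apply: Stanley_Reisner_sub.
(* The exponent and the factor depend on i; the sum of the exponents and the
   product of the factors will serve all i in A. *)
have gen i : exists sN : S * nat, ~ coord_prime A sN.1 /\
    (i \in A -> ideal_gen (range a) (sN.1 * 'X_i ^+ sN.2)).
  have [iA|iA] := boolP (i \in A); last first.
    by exists (1, 0%N); split=> //; have /prime_idealP[] := pA.
  pose g : S := \prod_(j in G) 'X_j.
  have : radical (ideal_gen (range r)) (to_loc mP ('X_i * g)).
    rewrite rE; apply/sub_radical/sub_loc_ideal/sub_ideal_gen.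
    move: iA; rewrite inE => iG.
    by exists (i |: G)%SET; rewrite ?facet_addN // big_setU1.
  move=> [N]; rewrite -rmorphXn.
  move/(clear_denominators (fun j => (abP j).1) (fun j => (abP j).2)).
  move=> [u [p [mu gp]]]; rewrite -rmorphM => /to_loc_inj e.
  exists (u * g ^+ N, N); split=> /= [|_]; last first.
    by rewrite -mulrA -exprMn mulrC [g * _]mulrC mulrC e.
  have /prime_idealP[_ _ Ap] := pA; case/Ap => [/Am//|/(primeX pA)].
  by case/(prime_prod pA) => j jG /coord_primeX; rewrite inE jG.
have [sN sNP] := choice gen.
apply: (@coord_prime_generators_ge k n A l a
  (\prod_i (sN i).1) (\sum_i (sN i).2)) => //.
  by case/(prime_prod pA) => i _; apply: (sNP i).1.
move=> i iA; rewrite (bigD1 i) //= [X in _ ^+ X](bigD1 i) //= exprD mulrACA mulrC.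
by apply: ideal_genM; apply: (sNP i).2.
Qed.

End StanleyReisner.

Theorem corollary4p2p4 (k : fieldType) (k_infinite : infinite_set [set: k])
    (n : nat) (Delta : {set {set 'I_n}}) (Delta_matroid : is_matroid Delta) :
  set_theoretic_complete_intersection
    (loc_ideal (irrelevant_ideal_prime k n) (Stanley_Reisner k Delta)).
Proof.
have [G fG] := exists_facet Delta_matroid.
exists #|(~: G)%SET|; split; first exact: Stanley_Reisner_height.
split; first exact: Stanley_Reisner_generated.
by move=> l; apply: Stanley_Reisner_ara_ge.
Qed.
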